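(* Let $G$ be a finite abelian group of order $v$, let $D$ be a subset of $G$ with $|D| = k$, and let $\lambda$ be an integer satisfying $k(k-1) = \lambda(v-1)$. Then $D$ is a $(v,k,\lambda)$ difference set in $G$ if and only if \[ |\chi(D)|^2 = k-\lambda \quad \text{for all nonprincipal characters } \chi \text{ of } G. \]
   Context: The group $G$ is finite and abelian, written multiplicatively, with identity $1_G$. A $k$-subset $D$ of a group $G$ of order $v$ is a $(v,k,\lambda)$ difference set in $G$ if the multiset $\{\{ xy^{-1} \mid x,y \in D,\ x \ne y \}\}$ contains each nonidentity element of $G$ exactly $\lambda$ times. A character of $G$ is a group homomorphism $\chi$ from $G$ to the multiplicative group $\mathbb{C}^*$ of the complex field. The principal character is the one mapping every element of $G$ to $1$; all other characters are nonprincipal. For a subset $D \subseteq G$, the character sum of $\chi$ on $D$ is $\chi(D) = \sum_{g \in D} \chi(g) \in \mathbb{C}$. *)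

(* Defs.v *)
From mathcomp Require Import all_boot all_order all_fingroup all_algebra.
From mathcomp Require Import reals complex.

Set Implicit Arguments.
Unset Strict Implicit.
Unset Printing Implicit Defensive.

Import Order.TTheory GRing.Theory Num.Theory.
Local Open Scope ring_scope.

(* The finite group G is the whole of the finGroupType gT.  A seq is read as
   a multiset, [count_mem g] being the multiplicity of g. *)
Definition quotients (gT : finGroupType) (D : {set gT}) : seq gT :=
  [seq (p.1 * p.2^-1)%g | p <- enum (setX D D) & p.1 != p.2].

Definition difference_set (gT : finGroupType) (v k : nat) (lambda : int)
    (D : {set gT}) : Prop :=
  [/\ #|[set: gT]| = v,
      #|D| = k
    & forall g : gT, g != 1%g -> (count_mem g (quotients D))%:Z = lambda].

(* Homomorphisms from gT to the multiplicative group of nonzero elements of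
   the field R[i] of complex numbers over R. *)
Definition group_character (R : realType) (gT : finGroupType)
    (chi : gT -> complex R) : Prop :=
  (forall x, chi x != 0) /\ (forall x y, chi (x * y)%g = chi x * chi y).

Definition principal (R : realType) (gT : finGroupType)
    (chi : gT -> complex R) : Prop :=
  forall x, chi x = 1.

Definition char_sum (R : realType) (gT : finGroupType)
    (chi : gT -> complex R) (D : {set gT}) : complex R :=
  \sum_(g in D) chi g.

(* Main.v *)
(* Let c(g) be the multiplicity of g among the quotients of D, so that
   |chi(D)|^2 = k + \sum_g c(g) chi(g).  Put h(g) = c(g) - lambda for g != 1
   and h(1) = 0; then |chi(D)|^2 = (k - lambda) + lambda \sum_g chi(g) +
   \sum_g h(g) chi(g), and D is a difference set iff h = 0.  The middle sum
   vanishes for nonprincipal chi.  Conversely, the hypothesis on |chi(D)| for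
   nonprincipal chi and k(k-1) = lambda(v-1) for the principal one say that
   h is orthogonal to every character, hence h = 0. *)

Require Import Defs.
From mathcomp Require Import all_boot all_order all_fingroup all_algebra.
From mathcomp Require Import reals complex.
From mathcomp Require Import cyclic separable cyclotomic mxrepresentation.

Import Order.TTheory GRing.Theory Num.Theory.

Local Open Scope ring_scope.

(** By Lagrange, [rG x] is a root of ['X^#|G| - 1]. This polynomial splits over [F], with distinct
    roots because [#|G|] is invertible in [F], so the minimal polynomial of [rG x] has simple
    roots. *)
Lemma mx_repr_diagonalizable (F : closedFieldType) (gT : finGroupType)
    (G : {group gT}) (n : nat) (rG : mx_representation F G n) (x : gT) :
  #|G|%:R != 0 :> F -> x \in G -> diagonalizable (rG x).
Proof.
case: n rG => [|n] rG nzG Gx.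
  by exists 1%:M; rewrite ?unitmx1 //; apply/is_diag_mxP => -[].
have [r Dr] := closed_field_poly_normal ('X^#|G| - 1 : {poly F}).
have sepX : separable_poly ('X^#|G| - 1 : {poly F}).
  by rewrite separable_Xn_sub_1.
move: Dr; rewrite (eqP (monicXnsubC 1 (cardG_gt0 G))) scale1r => Dr.
apply/diagonalizableP; exists r.
  by rewrite -separable_prod_XsubC -Dr.
rewrite -Dr; apply: mxminpoly_min.
rewrite rmorphB rmorphXn rmorph1 /= horner_mx_X.
suff -> : rG x ^+ #|G| = 1 by rewrite subrr.
have powE m : rG x ^+ m = rG (x ^+ m)%g.
  elim: m => [|m IHm]; first by rewrite expr0 expg0 repr_mx1.
  by rewrite exprS expgS repr_mxM ?groupX // -IHm.
by rewrite powE expg_cardG // repr_mx1.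
Qed.

(* The regular representation of an abelian group is simultaneously
   diagonalizable, and the diagonal entries are characters: so [h] annihilates
   it, while the row of index 1 of the resulting matrix lists the values of [h]. *)
Lemma character_sums_eq0 (F : closedFieldType) (gT : finGroupType)
    (h : gT -> F) :
  abelian [set: gT] -> #|[set: gT]|%:R != 0 :> F ->
  (forall chi : gT -> F, (forall x, chi x != 0) ->
     (forall x y, chi (x * y)%g = chi x * chi y) -> \sum_x h x * chi x = 0) ->
  forall x, h x = 0.
Proof.
move=> cGG nzG sum0.
pose rG := regular_repr F [set: gT]%G.
have rGM x y : rG (x * y)%g = rG x *m rG y by rewrite repr_mxM ?inE.
have [|P Pu /allP PD] := (codiagonalizableP [seq rG x | x : gT]).1.
  split=> [_ _ /mapP[x _ ->] /mapP[y _ ->]|_ /mapP[x _ ->]].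
    rewrite /comm_mx -!rGM; congr (rG _).
    by apply: (centsP cGG); rewrite inE.
  by apply: mx_repr_diagonalizable; rewrite ?inE.
have diagP x : is_diag_mx (P *m rG x *m invmx P).
  rewrite -conjumx //; apply: (PD (rG x)); apply/map_f; exact: mem_enum.
have conj_sum : P *m (\sum_x h x *: rG x) *m invmx P = 0.
  rewrite mulmx_sumr mulmx_suml; apply/matrixP => i j.
  rewrite summxE [RHS]mxE; have [<-{j}|nij] := eqVneq i j; last first.
    apply: big1 => x _; rewrite -scalemxAr -scalemxAl mxE.
    by rewrite (is_diag_mxP (diagP x)) ?mulr0.
  (* Diagonal matrices multiply entrywise, so the [i]-th diagonal entry is a character and [sum0]
     applies to it. *)
  pose chi x := (P *m rG x *m invmx P) i i.
  have chiM x y : chi (x * y)%g = chi x * chi y.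
    rewrite /chi rGM.
    have -> : P *m (rG x *m rG y) *m invmx P =
              (P *m rG x *m invmx P) *m (P *m rG y *m invmx P).
      by rewrite !mulmxA mulmxKV.
    rewrite mxE (bigD1 i) //= big1 ?addr0 // => l nli.
    by rewrite (is_diag_mxP (diagP x)) ?mul0r // eq_sym.
  have chi1 : chi 1%g = 1 by rewrite /chi repr_mx1 mulmx1 mulmxV // mxE eqxx.
  have chi_neq0 x : chi x != 0.
    apply: contra_eq_neq chi1 => chix0.
    by rewrite -(mulgV x) chiM chix0 mul0r eq_sym oner_eq0.
  rewrite -[RHS](sum0 chi chi_neq0 chiM); apply: eq_bigr => x _.
  by rewrite -scalemxAr -scalemxAl mxE.
have sum_rG : \sum_x h x *: rG x = 0.
  by rewrite -[LHS](mulKmx Pu) -[P *m _](mulmxKV Pu) conj_sum mul0mx mulmx0.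
(* The matrices [rG y] are linearly independent: [gring_proj x] maps [rG y] to 1 if [y = x] and to 0
   otherwise, so it extracts the coefficient [h x]. *)
move=> x; have : gring_proj (G := [set: gT]%G) x (\sum_y h y *: rG y) = 0.
  by rewrite sum_rG linear0.
rewrite linear_sum (bigD1 x) //= big1 => [|y nyx].
  rewrite linearZ /= gring_projE ?inE // eqxx addr0 => /matrixP/(_ 0 0).
  by rewrite !mxE mulr1.
by rewrite linearZ /= gring_projE ?inE // eq_sym (negPf nyx) scaler0.
Qed.

Lemma sum_count_mem (V : nmodType) (I : finType) (s : seq I) (f : I -> V) :
  \sum_(i <- s) f i = \sum_i f i *+ count_mem i s.
Proof.
elim: s => [|a s IHs]; first by rewrite big_nil big1 // => i _; rewrite mulr0n.
rewrite big_cons IHs [RHS](eq_bigr (fun i => f i *+ (a == i) + f i *+ count_mem i s)).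
  rewrite big_split /=; congr (_ + _).
  rewrite (bigD1 a) //= eqxx big1 ?addr0 // => i nia.
  by rewrite eq_sym (negPf nia).
by move=> i _; rewrite /= mulrnDr.
Qed.

(** Each diagonal pair [x = y] contributes [f 1]; the other pairs are those listed by
    [quotients D]. *)
Lemma sum_quotients (V : nmodType) (gT : finGroupType) (D : {set gT}) (f : gT -> V) :
  \sum_(x in D) \sum_(y in D) f (x * y^-1)%g =
  f 1%g *+ #|D| + \sum_(q <- quotients D) f q.
Proof.
rewrite /quotients big_map big_filter_cond big_enum_cond /=.
rewrite (eq_bigl (fun p => (p.1 \in D) && ((p.2 \in D) && (p.1 != p.2)))); last first.
  by move=> p; rewrite andbT inE andbA.
rewrite -(pair_big_dep (mem D) (fun x y => (y \in D) && (x != y))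
            (fun x y => f (x * y^-1)%g)) /= -sumr_const -big_split /=.
apply: eq_bigr => x xD; rewrite (bigD1 x) //= mulgV; congr (_ + _).
by apply: eq_bigl => y; rewrite eq_sym.
Qed.

Lemma count_mem_quotients1 (gT : finGroupType) (D : {set gT}) :
  count_mem 1%g (quotients D) = 0%N.
Proof.
apply/count_memPn; apply/mapP => -[p]; rewrite mem_filter => /andP[np _] /esym/eqP.
by rewrite -eq_mulgV1 (negPf np).
Qed.

Section Characters.

Variables (R : realType) (gT : finGroupType) (chi : gT -> complex R).
Hypothesis chiP : group_character chi.

Lemma group_character1 : chi 1%g = 1.
Proof.
case: chiP => nz chiM; apply: (mulfI (nz 1%g)).
by rewrite -chiM mulg1 mulr1.
Qed.

(** Since [x] has finite order, [chi x] is a root of unity; it has modulus 1, and its conjugate is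
    its inverse. *)
Lemma group_characterV (x : gT) : (chi x)^* = chi x^-1%g.
Proof.
have [nz chiM] := chiP.
have chiX m : chi (x ^+ m)%g = chi x ^+ m.
  elim: m => [|m IHm]; first exact: group_character1.
  by rewrite expgS exprS chiM IHm.
have norm1 : `|chi x| = 1.
  apply/eqP; rewrite -(@pexpr_eq1 _ _ #[x]%g) ?order_gt0 //.
  by rewrite -normrX -chiX expg_order group_character1 normr1.
apply: (mulfI (nz x)).
by rewrite -chiM mulgV group_character1 -normCK norm1 expr1n.
Qed.

(** Translating the index by [x] multiplies the sum by [chi x]; a nonzero sum would force
    [chi x = 1] for every [x]. *)
Lemma sum_nonprincipal : ~ principal chi -> \sum_g chi g = 0.
Proof.
have [_ chiM] := chiP => nprinc; apply/eqP.
have [//|nz] := boolP (_ == _); case: nprinc => x.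
apply: (mulIf nz); rewrite mul1r mulr_sumr [RHS](reindex_inj (mulgI x)).
by apply: eq_bigr => y _; rewrite chiM.
Qed.

(** The product of the sum and its conjugate expands into the double sum of [chi (x * y^-1)] over
    [D]. *)
Lemma char_sum_normE (D : {set gT}) :
  `|char_sum chi D| ^+ 2 = #|D|%:R + \sum_g chi g *+ count_mem g (quotients D).
Proof.
have [_ chiM] := chiP.
rewrite normCK /char_sum rmorph_sum /= -sum_count_mem -group_character1.
rewrite -sum_quotients mulr_suml; apply: eq_bigr => x _.
by rewrite mulr_sumr; apply: eq_bigr => y _; rewrite group_characterV chiM.
Qed.

Lemma char_sum_norm_excess (D : {set gT}) (lambda : int) :
  `|char_sum chi D| ^+ 2 = (#|D|%:Z - lambda)%:~R + lambda%:~R * \sum_g chi g +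
    \sum_g (if g == 1%g then 0 else (count_mem g (quotients D))%:Z - lambda)%:~R
             * chi g.
Proof.
rewrite char_sum_normE intrB -!addrA; congr (_ + _).
(* At [g = 1] the multiplicity is 0, and the term [lambda * chi 1 = lambda] cancels the [- lambda]
   of the constant; the other terms agree one by one. *)
rewrite mulr_sumr -big_split /= !(bigD1 (1%g : gT) isT) /=.
rewrite count_mem_quotients1 mulr0n add0r eqxx mul0r addr0 group_character1 mulr1.
rewrite addrA addNr add0r; apply: eq_bigr => g /negPf ->.
by rewrite -mulrDl -intrD addrC subrK -mulr_natl.
Qed.

End Characters.

Theorem theorem2p15 (R : realType) (gT : finGroupType)
    (abelG : abelian [set: gT]) (v k : nat) (lambda : int) (D : {set gT})
    (cardG : #|[set: gT]| = v) (cardD : #|D| = k)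
    (kkE : k%:Z * (k%:Z - 1) = lambda * (v%:Z - 1)) :
  difference_set v k lambda D <->
  (forall chi : gT -> complex R, group_character chi -> ~ principal chi ->
     `|char_sum chi D| ^+ 2 = (k%:Z - lambda)%:~R).
Proof.
split=> [[_ _ countD] chi chiP nprinc | normD].
  rewrite (char_sum_norm_excess _ _ _ chiP D lambda).
  rewrite sum_nonprincipal // mulr0 addr0 cardD.
  rewrite big1 ?addr0 // => g _; case: eqP => [|/eqP ng1]; first by rewrite mul0r.
  by rewrite countD // subrr mul0r.
split=> // g ng1.
pose h (x : gT) : complex R :=
  (if x == 1%g then 0 else (count_mem x (quotients D))%:Z - lambda)%:~R.
suff /eqP : h g = 0.
  by rewrite /h (negPf ng1) intr_eq0 subr_eq0 => /eqP.
apply: character_sums_eq0 => //.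
  by rewrite pnatr_eq0 -lt0n cardG_gt0.
move=> chi nz chiM; have chiP : group_character chi by [].
have := char_sum_norm_excess _ _ _ chiP D lambda; rewrite cardD.
have [/forallP princ | /forallPn/= [x nx]] := boolP [forall x, chi x == 1].
  have sum1 : \sum_x chi x = v%:R.
    by rewrite (eq_bigr (fun=> 1)) ?sumr_const -?cardsT ?cardG // => x _; apply/eqP.
  have -> : char_sum chi D = k%:R.
    by rewrite /char_sum (eq_bigr (fun=> 1)) ?sumr_const ?cardD // => x _; apply/eqP.
  (* For the principal character, [sumE] expresses [k ^ 2] as [k - lambda + lambda * v] plus the sum
     to be killed, and [kkE] says that [k ^ 2] equals the first part alone. *)
  rewrite sum1 normr_nat => sumE; apply: (addrI ((k%:Z - lambda)%:~R + lambda%:~R * v%:R)).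
  rewrite -sumE addr0 -[v%:R]/(v%:Z%:~R) -[k%:R]/(k%:Z%:~R) -intrM -intrD -rmorphXn /=.
  congr (_%:~R); move: kkE; rewrite !mulrBr !mulr1 expr2 => /eqP.
  by rewrite subr_eq => /eqP ->; rewrite addrC addrA [LHS]addrAC.
(* For a nonprincipal character, [k - lambda] stands on both sides and cancels, which leaves the sum
   of [h x * chi x] equal to 0. *)
rewrite normD // => [|princ]; last by rewrite princ eqxx in nx.
rewrite sum_nonprincipal // => [|princ]; last by rewrite princ eqxx in nx.
by rewrite mulr0 addr0 -[LHS]addr0 => /addrI <-.
Qed.
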